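(* Let $n\ge1$ be an integer and let $\mu$ be a (not necessarily product) probability distribution on $\{0,1\}^{\mathbb N}$ with mean $\boldsymbol p=\mathbb E_{X\sim\mu}[X]$, and suppose that $p(j)\in[0,\frac12]$ and $p(j)\ge p(j+1)$ for all $j\ge1$. Then, with universal constants in all the relations $\lesssim$: (i) If $p(j)\le\frac1{2nj}$ for all $j\ge1$, then $p(1)\lesssim\Delta_n(\mu)\lesssim\frac1n\wedge\sum_{j\ge1}p(j)$. (ii) Otherwise, $$p(1)\wedge\sqrt{\frac{p(1)}{n}}\lesssim\Delta_n(\mu)\lesssim1\wedge\sup_{j\ge1}\left(\sqrt{\frac{p(j)\ln(j+1)}{n}}\vee\frac{\ln(j+1)}{n\ln\left(2+\frac{\ln(j+1)}{np(j)}\right)}\right).$$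
   Context: Notation: $a\vee b=\max(a,b)$, $a\wedge b=\min(a,b)$; $A\lesssim B$ means $A\le CB$ for a universal constant $C>0$ (independent of $n$, $\mu$). For i.i.d. samples $X_1,\dots,X_n\sim\mu$, $\hat{\boldsymbol p}_n=\frac1n\sum_{i=1}^nX_i$ and $\Delta_n(\mu)=\mathbb E\|\hat{\boldsymbol p}_n-\boldsymbol p\|_\infty=\mathbb E\sup_{j\ge1}|\hat p_n(j)-p(j)|$. When $p(j)=0$ the term $\frac{\ln(j+1)}{n\ln(2+\ln(j+1)/(np(j)))}$ is interpreted as $0$. *)

(* Defs.v *)
From HB Require Import structures.
From mathcomp Require Import all_boot all_order all_algebra.
From mathcomp Require Import all_classical all_reals all_analysis.

Set Implicit Arguments.
Unset Strict Implicit.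
Unset Printing Implicit Defensive.

Import Order.TTheory GRing.Theory Num.Theory.
Import numFieldNormedType.Exports.

Local Open Scope classical_set_scope.
Local Open Scope ring_scope.

(* Coordinates are indexed from 0: coordinate [j : nat] below is the
   coordinate j+1 of the usual indexing by the integers j >= 1, so that a usual
   "ln (j + 1)" reads [ln j.+2%:R]. *)

(* {0,1}^N with its product sigma-algebra, generated by the coordinate events. *)
Definition binseq := g_sigma_algebraType
  (range (fun j : nat => [set x : nat -> bool | x j])).

Section binary_mean_estimation.
Context {R : realType}.

Definition mean (mu : probability binseq R) (j : nat) : R :=
  fine 'E_mu[fun x : binseq => (x j)%:R].

Section samples.
Context {d : measure_display} {Omega : measurableType d}
  (P : probability Omega R) (n : nat).

Definition mutually_independent (X : 'I_n -> {RV P >-> binseq}) : Prop :=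
  forall A : 'I_n -> set binseq, (forall i, measurable (A i)) ->
    P (\bigcap_(i in [set: 'I_n]) (X i @^-1` A i)) =
    (\prod_(i < n) P (X i @^-1` A i))%E.

(* Laws are compared on measurable sets only, because the value of a measure
   outside the sigma-algebra is not specified. *)
Definition iid_samples (mu : probability binseq R)
    (X : 'I_n -> {RV P >-> binseq}) : Prop :=
  mutually_independent X /\
  forall (i : 'I_n) (A : set binseq),
    measurable A -> distribution P (X i) A = mu A.

Definition emp_mean (X : 'I_n -> {RV P >-> binseq}) (w : Omega) (j : nat) : R :=
  n%:R^-1 * \sum_(i < n) (X i w j)%:R.

(* The real supremum is the genuine one: all deviations lie in [0, 1]. *)
Definition Delta (mu : probability binseq R)
    (X : 'I_n -> {RV P >-> binseq}) : \bar R :=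
  'E_P[fun w => sup (range (fun j : nat => `|emp_mean X w j - mean mu j|))].

End samples.

(* The test [q == 0] is needed: with [x / 0 = 0] the bare formula would yield
   [ln j.+2%:R / (n%:R * ln 2)] instead of the intended limit value 0. *)
Definition poisson_term (n j : nat) (q : R) : R :=
  if q == 0 then 0
  else ln j.+2%:R / (n%:R * ln (2 + ln j.+2%:R / (n%:R * q))).

End binary_mean_estimation.

(* Main.v *)
(** For a binomial variable [N] with parameters [n] and [p], everything rests on
    its generating function [E z^N = (1 - p + p z)^n] and its second and fourth
    central moments.  Since the coordinates may depend on each other, every
    upper bound comes from [sup_j |p^_j - p_j| <= K + sum_j Z_j] with [Z_j >= 0]
    a function of the j-th coordinate only.  When [n p_j <= 1/(2j)], take
    [Z_j = z^(N_j - 2) / n] with [z = 2j], because [N <= 1 + z^(N - 2)].  In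
    general, exponential tilting of [N_j - n p_j] by [t], together with
    [x <= A + e^(x - A)] for [A = 11 ln (j+1)], gives [K = O(S)] and
    [E Z_j = O(S / j^2)], where [S] is the supremum in the statement.  The lower
    bounds only use the first coordinate. *)

Require Import Defs.
From HB Require Import structures.
From mathcomp Require Import all_boot all_order all_algebra ring lra.
From mathcomp Require Import all_classical all_reals all_analysis.
From mathcomp Require Import measurable_realfun.

Import Order.TTheory GRing.Theory Num.Theory.
Import numFieldNormedType.Exports.

Local Open Scope classical_set_scope.
Local Open Scope ring_scope.

(** * Moments and generating function of the binomial law *)

Section binomial_expectation.
Context {R : realFieldType}.
Implicit Types (n k : nat) (p c z : R) (f g : nat -> R).

(* [E f(N)] for [N] binomial with parameters [n] and [p], conditioning on the
   first trial. *)
Fixpoint bexp n p f : R :=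
  if n is m.+1 then p * bexp m p (f \o S) + (1 - p) * bexp m p f else f 0%N.

Lemma bexpD n p f g : bexp n p (fun k => f k + g k) = bexp n p f + bexp n p g.
Proof.
elim: n f g => //= n IH f g.
by rewrite (IH (f \o S) (g \o S)) IH; ring.
Qed.

Lemma bexpZ n p c f : bexp n p (fun k => c * f k) = c * bexp n p f.
Proof. by elim: n f => //= n IH f; rewrite (IH (f \o S)) IH; ring. Qed.

Lemma bexp_cst n p c : bexp n p (fun=> c) = c.
Proof. by elim: n => //= n IH; rewrite [X in p * X]IH IH; ring. Qed.

Lemma le_bexp n p f g : 0 <= p <= 1 -> (forall k, f k <= g k) ->
  bexp n p f <= bexp n p g.
Proof.
move=> /andP[p0 p1]; elim: n f g => //= n IH f g fg.
by apply: lerD; apply: ler_wpM2l; rewrite ?subr_ge0//; apply: IH => k /=.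
Qed.

Lemma bexp_ge0 n p f : 0 <= p <= 1 -> (forall k, 0 <= f k) -> 0 <= bexp n p f.
Proof. by move=> p01 f0; rewrite -[leLHS](bexp_cst n p 0) le_bexp. Qed.

Lemma bexp_expr n p z : bexp n p (fun k => z ^+ k) = (1 - p + p * z) ^+ n.
Proof.
elim: n => //= n IH.
have -> : (fun k => z ^+ k) \o S = (fun k => z * z ^+ k).
  by apply/funext => k /=; rewrite exprS.
by rewrite bexpZ IH exprS; ring.
Qed.

Lemma bexp_id n p : bexp n p (fun k => k%:R) = n%:R * p.
Proof.
elim: n => [|n IH] /=; first by rewrite mul0r.
have -> : (fun k => k%:R) \o S = (fun k => k%:R + 1) :> (nat -> R).
  by apply/funext => k /=; rewrite -natr1.
by rewrite bexpD IH bexp_cst -natr1; ring.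
Qed.

(** The shift [c] is free because conditioning on the first trial turns [c] into [1 + c];
    [c = - (n%:R * p)] gives the variance. *)
Lemma bexp_sqr n p c : bexp n p (fun k => (k%:R + c) ^+ 2) =
  (n%:R * p + c) ^+ 2 + n%:R * p * (1 - p).
Proof.
elim: n c => [|n IH] c /=; first by rewrite !mul0r add0r addr0.
have -> : (fun k => (k%:R + c) ^+ 2) \o S = (fun k => (k%:R + (1 + c)) ^+ 2).
  by apply/funext => k /=; rewrite -natr1 addrA.
by rewrite !IH -natr1; ring.
Qed.

(** Expansion of [((N - np) + m)^4]: the third and fourth central moments are [s (1 - 2p)] and
    [3 s^2 + s (1 - 6p (1 - p))]. *)
Lemma bexp_pow4 n p c : bexp n p (fun k => (k%:R + c) ^+ 4) =
  let m := n%:R * p + c in let s := n%:R * p * (1 - p) in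
  m ^+ 4 + 6 * m ^+ 2 * s + 4 * m * s * (1 - 2 * p) + 3 * s ^+ 2 +
  s * (1 - 6 * p * (1 - p)).
Proof.
elim: n c => [|n IH] c /=; first by rewrite !mul0r; ring.
have -> : (fun k => (k%:R + c) ^+ 4) \o S = (fun k => (k%:R + (1 + c)) ^+ 4).
  by apply/funext => k /=; rewrite -natr1 addrA.
by rewrite !IH /= -natr1; ring.
Qed.

(** Identifies the recursion [bexp] with the law of [n] independent bits: splitting off bit 0
    through [cons] is one recursion step. *)
Lemma bexp_ffun n p f :
  \sum_(g : {ffun 'I_n -> bool})
    (\prod_i (if g i then p else 1 - p)) * f (\sum_i g i)%N = bexp n p f.
Proof.
elim: n f => [|n IH] f /=.
  rewrite (bigD1 [ffun=> false])//= !big_ord0 mul1r big1 ?addr0// => g.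
  by case/eqP; apply/ffunP => -[].
pose cons (bg : bool * {ffun 'I_n -> bool}) : {ffun 'I_n.+1 -> bool} :=
  [ffun i => if unlift ord0 i is Some j then bg.2 j else bg.1].
have cons0 bg : cons bg ord0 = bg.1 by rewrite ffunE unlift_none.
have consS bg i : cons bg (lift ord0 i) = bg.2 i by rewrite ffunE liftK.
rewrite (reindex cons); last first.
  apply: onW_bij; exists
    (fun g : {ffun 'I_n.+1 -> bool} => (g ord0, [ffun i => g (lift ord0 i)])).
    move=> [b g]; rewrite cons0/=; congr pair.
    by apply/ffunP => i; rewrite ffunE consS.
  move=> g; apply/ffunP => i; rewrite ffunE.
  by case: unliftP => [j|] ->//=; rewrite ffunE.
rewrite -(pair_bigA _ (fun (b : bool) (g : {ffun 'I_n -> bool}) =>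
  \prod_i (if cons (b, g) i then p else 1 - p) * f (\sum_i cons (b, g) i)%N)).
rewrite big_bool/= -!IH !big_distrr/=; congr (_ + _).
all: apply: eq_bigr => g _; rewrite !big_ord_recl !cons0/= mulrA.
- congr (_ * _ * f _); first by apply: eq_bigr => i _; rewrite consS.
  by rewrite add1n; congr S; apply: eq_bigr => i _; rewrite consS.
- congr (_ * _ * f _); first by apply: eq_bigr => i _; rewrite consS.
  by rewrite add0n; apply: eq_bigr => i _; rewrite consS.
Qed.

End binomial_expectation.

(** * From i.i.d. samples to binomial coordinate counts *)

Section coordinate_counts.
Context {R : realType}.

Lemma measurable_coord (j : nat) (b : bool) :
  measurable ([set x : binseq | x j = b] : set binseq).
Proof.
have mj : measurable ([set x : binseq | x j] : set binseq).
  by apply: sub_sigma_algebra; exists j.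
case: b => //.
rewrite [X in measurable X](_ : _ = ~` [set x : binseq | x j]).
  exact: measurableC.
by apply/seteqP; split => x /= /negP; rewrite ?negbK => // /negPf.
Qed.

Lemma measure_coord (mu : probability binseq R) (j : nat) :
  mu [set x : binseq | x j = true] = (mean mu j)%:E.
Proof.
have mj := measurable_coord j true.
rewrite /mean [X in fine ('E_mu[X])](_ : _ = \1_[set x : binseq | x j = true]).
  by rewrite expectation_indic// fineK// fin_num_measure.
apply/funext => x; rewrite indicE; case xj: (x j).
  by rewrite mem_set.
by rewrite memNset//= xj.
Qed.

Context {d : measure_display} {Omega : measurableType d}
  (P : probability Omega R) (n : nat) (mu : probability binseq R)
  (X : 'I_n -> {RV P >-> binseq}).

Definition coord_count (j : nat) (w : Omega) : nat := (\sum_i X i w j)%N.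

Lemma coord_count_le j w : (coord_count j w <= n)%N.
Proof.
rewrite -[leqRHS]card_ord -sum1_card; apply: leq_sum => i _.
by case: (X i w j).
Qed.

Lemma emp_meanE w j : emp_mean X w j = (coord_count j w)%:R / n%:R.
Proof. by rewrite /emp_mean natr_sum mulrC. Qed.

Let pattern j (g : {ffun 'I_n -> bool}) : set Omega :=
  \bigcap_(i in [set: 'I_n]) (X i @^-1` [set x : binseq | x j = g i]).

Let measurable_pattern j g : measurable (pattern j g).
Proof.
apply: fin_bigcap_measurable => // i _.
exact: measurable_funPTI (measurable_coord j (g i)).
Qed.

(** The events [pattern j g] partition [Omega], so a function of the count is a finite combination
    of indicators; its measurability and integral follow. *)
Let fun_coord_countE j (f : nat -> R) w : f (coord_count j w) =
  \sum_(g : {ffun 'I_n -> bool}) f (\sum_i g i)%N * \1_(pattern j g) w.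
Proof.
pose g0 : {ffun 'I_n -> bool} := [ffun i => X i w j].
have -> : coord_count j w = (\sum_i g0 i)%N.
  by apply: eq_bigr => i _; rewrite ffunE.
rewrite (bigD1 g0)//= indicE mem_set; last by move=> i _ /=; rewrite ffunE.
rewrite mulr1 [X in _ + X]big1 ?addr0//.
move=> g /eqP gg0; rewrite indicE memNset ?mulr0// => wg; apply: gg0.
by apply/ffunP => i; rewrite ffunE; apply/esym; exact: (wg i).
Qed.

Lemma measurable_coord_count j (f : nat -> R) :
  measurable_fun [set: Omega] (fun w => f (coord_count j w)).
Proof.
under eq_fun do rewrite fun_coord_countE.
by apply: measurable_sum => g; exact: measurable_funM.
Qed.

Hypothesis iidX : iid_samples mu X.

(** Independence and the common law of the samples enter the argument only here. *)
Let prob_pattern j g : P (pattern j g) =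
  (\prod_i (if g i then mean mu j else 1 - mean mu j))%:E.
Proof.
have [indX lawX] := iidX.
rewrite indX; last by move=> i; exact: measurable_coord.
rewrite -prodEFin; apply: eq_bigr => i _.
rewrite -[LHS]/(distribution P (X i) _) lawX; last exact: measurable_coord.
case: (g i); first exact: measure_coord.
rewrite [X in mu X](_ : _ = ~` [set x : binseq | x j = true]).
  rewrite probability_setC; last exact: measurable_coord.
  by rewrite measure_coord EFinB.
by apply/seteqP; split => x /=; case: (x j).
Qed.

Lemma integral_coord_count j (f : nat -> R) : (forall k, 0 <= f k) ->
  (\int[P]_w (f (coord_count j w))%:E = (bexp n (mean mu j) f)%:E)%E.
Proof.
move=> f0; rewrite -bexp_ffun.
under eq_integral do rewrite fun_coord_countE -sumEFin.
rewrite ge0_integral_sum//; last 2 first.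
- by move=> g; apply/measurable_EFinP; exact: measurable_funM.
- by move=> g w _; rewrite lee_fin mulr_ge0.
rewrite -sumEFin; apply: eq_bigr => g _.
rewrite (integralZl_indic _ (fun=> pattern j g))//; last first.
  by move=> /lt_geF; rewrite f0.
rewrite integral_indic// setIT EFinM muleC; congr (_ * _)%E.
exact: prob_pattern.
Qed.

Lemma mean_ge0_le1 j : 0 <= mean mu j <= 1.
Proof.
rewrite -(lee_fin 0) -(lee_fin _ 1) -measure_coord measure_ge0/=.
by apply: probability_le1; exact: measurable_coord.
Qed.

Let dev j w : R := `|emp_mean X w j - mean mu j|.

Let dev_le1 j w : dev j w <= 1.
Proof.
have /andP[m0 m1] := mean_ge0_le1 j.
suff /andP[e0 e1] : 0 <= emp_mean X w j <= 1 by rewrite ler_norml; lra.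
rewrite emp_meanE divr_ge0//=.
(* For [n = 0] the quotient is 0, as the inverse of 0 is 0. *)
have [n0|n0] := posnP n; first by rewrite n0 invr0 mulr0.
by rewrite ler_pdivrMr ?ltr0n// mul1r ler_nat coord_count_le.
Qed.

Let has_ubound_dev w : has_ubound (range (dev ^~ w)).
Proof. by exists 1 => _ [j _ <-]; exact: dev_le1. Qed.

Let sup_dev w : R := sup (range (dev ^~ w)).

Let measurable_dev j : measurable_fun [set: Omega] (dev j).
Proof.
rewrite /dev; under eq_fun do rewrite emp_meanE.
exact: (measurable_coord_count j (fun k => `|k%:R / n%:R - mean mu j|)).
Qed.

Let measurable_sup_dev : measurable_fun [set: Omega] sup_dev.
Proof.
have := @measurable_fun_sups _ _ R setT dev 0%N
  (fun w _ => has_ubound_dev w) measurable_dev.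
congr measurable_fun; apply/funext => w; congr sup.
by apply/seteqP; split => _ [j _ <-]; exists j.
Qed.

Let dev_le_sup j w : dev j w <= sup_dev w.
Proof. by apply: ub_le_sup => //; exists j. Qed.

Let sup_dev_ge0 w : 0 <= sup_dev w.
Proof. by apply: le_trans (dev_le_sup 0%N w); exact: normr_ge0. Qed.

Let DeltaE : Delta mu X = (\int[P]_w (sup_dev w)%:E)%E.
Proof. by rewrite /Delta unlock. Qed.

Lemma Delta_ge j :
  ((bexp n (mean mu j) (fun k => `|k%:R / n%:R - mean mu j|))%:E
    <= Delta mu X)%E.
Proof.
rewrite DeltaE -integral_coord_count//; apply: ge0_le_integral => //.
- apply/measurable_EFinP.
  exact: (measurable_coord_count j (fun k => `|k%:R / n%:R - mean mu j|)).
- exact/measurable_EFinP.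
- by move=> w _; rewrite lee_fin -emp_meanE dev_le_sup.
Qed.

(* The coordinates may be dependent: the supremum is dominated by a constant
   plus a sum over all of them. *)
Lemma Delta_le (K : R) (Z : nat -> nat -> R) : 0 <= K ->
  (forall j k, 0 <= Z j k) ->
  (forall j k, (k <= n)%N -> `|k%:R / n%:R - mean mu j| <= K + Z j k) ->
  (Delta mu X <= K%:E + \sum_(0 <= j <oo) (bexp n (mean mu j) (Z j))%:E)%E.
Proof.
move=> K0 Z0 devZ; rewrite DeltaE.
have mZ j : measurable_fun [set: Omega] (fun w => (Z j (coord_count j w))%:E).
  by apply/measurable_EFinP; exact: measurable_coord_count.
have Zge0 j w : (0 <= (Z j (coord_count j w))%:E)%E by rewrite lee_fin.
have mS : measurable_fun [set: Omega]
    (fun w => \sum_(0 <= j <oo) (Z j (coord_count j w))%:E)%E.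
  by apply: ge0_emeasurable_sum => // *; exact: Zge0.
have -> : (K%:E + \sum_(0 <= j <oo) (bexp n (mean mu j) (Z j))%:E =
    \int[P]_w (K%:E + \sum_(0 <= j <oo) (Z j (coord_count j w))%:E))%E.
  rewrite ge0_integralD//; last by move=> w _; exact: nneseries_ge0.
  congr (_ + _)%E.
    rewrite integral_cst// -[LHS]mule1; congr (_ * _)%E.
    exact/esym/probability_setT.
  rewrite integral_nneseries//.
  by apply: eq_eseriesr => j _; rewrite integral_coord_count.
apply: ge0_le_integral => //.
- by move=> w _; rewrite lee_fin.
- exact/measurable_EFinP.
- exact: emeasurable_funD.
move=> w _; set S := (X in (_ <= _ + X)%E).
have ZS j : ((Z j (coord_count j w))%:E <= S)%E.
  rewrite /S (@nneseriesD1 _ _ j)//.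
  by rewrite leeDl// nneseries_ge0//.
have: (0 <= S)%E by exact: nneseries_ge0.
(* Where the series diverges the bound is trivial; elsewhere [K + s], with [s] its real sum, bounds
   every deviation. *)
case: S ZS => [s|_ _|]//.
- move=> ZS _; rewrite lee_fin; apply: sup_le_ub.
    by exists (dev 0%N w), 0%N.
  move=> _ [j _ <-]; rewrite /dev emp_meanE.
  apply: le_trans (devZ j _ (coord_count_le j w)) _.
  by rewrite lerD2l -lee_fin.
- by rewrite addey// leey.
Qed.

End coordinate_counts.

(** * Deviation bounds for one binomial variable *)

Section binomial_deviation.
Context {R : realType}.
Implicit Types (n k j : nat) (p c z t x r L S : R).

(** Invert [1 - x <= e^(-x)]; the quadratic dominates [1 / (1 - x)] because [x <= 1/2]. *)
Lemma expR_le_quadratic x : x <= 2^-1 -> expR x <= 1 + x + 2 * x ^+ 2.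
Proof.
move=> x2; have x1 : 0 < 1 - x by lra.
apply: (@le_trans _ _ (1 - x)^-1).
  rewrite -[x in leLHS]opprK expRN lef_pV2 ?posrE ?expR_gt0//.
  exact: expR_ge1Dx.
rewrite -div1r ler_pdivrMr// -subr_ge0.
have -> : (1 + x + 2 * x ^+ 2) * (1 - x) - 1 = x ^+ 2 * (1 - 2 * x) by ring.
by rewrite mulr_ge0 ?sqr_ge0//; lra.
Qed.

Lemma expR1_le4 : expR 1 <= 4 :> R.
Proof.
have /expR_le_quadratic : 2^-1 <= 2^-1 :> R by [].
rewrite (_ : 1 + _ + _ = 2); last by field.
move=> e2; rewrite [1](splitr 1) div1r expRD.
apply: (@le_trans _ _ (2 * 2)); last by lra.
by apply: ler_pM; rewrite ?expR_ge0.
Qed.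

Lemma bexp_expr_le n p z : 0 <= p <= 1 -> 0 <= z ->
  bexp n p (fun k => z ^+ k) <= expR (n%:R * p * (z - 1)).
Proof.
move=> /andP[p0 p1] z0; rewrite bexp_expr -mulrA expRM_natl.
have q0 : 0 <= 1 - p + p * z by rewrite addr_ge0 ?mulr_ge0// subr_ge0.
rewrite lerXn2r ?nnegrE ?expR_ge0//.
by rewrite (le_trans _ (expR_ge1Dx _))//; lra.
Qed.

(** The exponent is the cumulant generating function of a centred Poisson variable of mean [np],
    which dominates the binomial one. *)
Lemma bexp_expR_le n p t : 0 <= p <= 1 ->
  bexp n p (fun k => expR (t * (k%:R - n%:R * p))) <=
  expR (n%:R * p * (expR t - 1 - t)).
Proof.
move=> p01.
have -> : (fun k => expR (t * (k%:R - n%:R * p))) =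
    (fun k => expR (- (t * (n%:R * p))) * expR t ^+ k).
  by apply/funext => k; rewrite -expRM_natl -expRD; congr expR; ring.
rewrite bexpZ.
have := bexp_expr_le n p (expR t) p01 (expR_ge0 _).
move=> /(ler_wpM2l (expR_ge0 (- (t * (n%:R * p))))) /le_trans; apply.
by rewrite -expRD ler_expR; lra.
Qed.

(** The deviation is at least [p (1 - N)], which is [p] at [N = 0] and nonpositive afterwards, and
    whose mean is [p (1 - np)]. *)
Lemma bexp_norm_ge_mean n p : (1 <= n)%N -> 0 <= p <= 1 -> n%:R * p <= 2^-1 ->
  p / 2 <= bexp n p (fun k => `|k%:R / n%:R - p|).
Proof.
move=> n1 p01 np2; have /andP[p0 p1] := p01.
apply: (@le_trans _ _ (bexp n p (fun k => p + - p * k%:R))).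
  by rewrite bexpD bexpZ bexp_cst bexp_id; nra.
apply: le_bexp => // -[|k].
  by rewrite mul0r mulr0 addr0 sub0r normrN ler_norm.
apply: le_trans (normr_ge0 _).
by rewrite -natr1; have : 0 <= k%:R :> R by []; nra.
Qed.

(* [|y| >= y^2/t - y^4/(4t^3)] bounds the first absolute moment from below by
   the second and fourth ones; [t = 2 sqrt(np)] balances the two terms. *)
Lemma bexp_norm_ge_sqrt n p : (1 <= n)%N -> 0 <= p <= 2^-1 ->
  2^-1 <= n%:R * p ->
  Num.sqrt (p / n%:R) <= 8 * bexp n p (fun k => `|k%:R / n%:R - p|).
Proof.
move=> n1 /andP[p0 p2] np2; have n0 : 0 < n%:R :> R by rewrite ltr0n.
pose u := Num.sqrt (n%:R * p); pose s := n%:R * p * (1 - p).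
have u2 : u ^+ 2 = n%:R * p by rewrite sqr_sqrtr//; lra.
have u0 : 0 < u by rewrite sqrtr_gt0; lra.
have su : u ^+ 2 / 2 <= s <= u ^+ 2 by rewrite /s u2; nra.
have -> : Num.sqrt (p / n%:R) = u / n%:R.
  rewrite -[RHS]ger0_norm ?divr_ge0 ?ltW// -sqrtr_sqr expr_div_n u2.
  by congr Num.sqrt; field; rewrite gt_eqF.
(* Coefficients of the quartic minorant at [t = 2u], divided by [n] because the deviation is
   [y / n]. *)
pose c1 := (2 * u * n%:R)^-1; pose c2 := - (32 * u ^+ 3 * n%:R)^-1.
pose y k : R := k%:R + - (n%:R * p).
have le_dev : bexp n p (fun k => c1 * y k ^+ 2 + c2 * y k ^+ 4) <=
    bexp n p (fun k => `|k%:R / n%:R - p|).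
  apply: le_bexp => [|k]; first by apply/andP; split; lra.
  have -> : k%:R / n%:R - p = y k / n%:R by rewrite /y; field; rewrite gt_eqF.
  rewrite normrM (@ger0_norm _ n%:R^-1) ?invr_ge0//.
  have -> : y k ^+ 4 = (y k ^+ 2) ^+ 2 by rewrite -exprM.
  rewrite -(real_normK (num_real (y k))).
  move: `|y k| (normr_ge0 (y k)) => a a0.
  rewrite -subr_ge0 (_ : _ - _ = a / n%:R *
    (1 - (a / (2 * u)) + (a / (2 * u)) ^+ 3 / 4)); last first.
    by rewrite /c1 /c2; field; rewrite !gt_eqF.
  rewrite mulr_ge0 ?divr_ge0//.
  have : 0 <= a / (2 * u) by rewrite divr_ge0// mulr_ge0// ltW.
  move: (a / _) => b b0.
  (* [1 - b + b^3/4 = b (b - 1)^2/4 + (b - 5/4)^2/2 + 7/32]. *)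
  by have := mulr_ge0 b0 (sqr_ge0 (b - 1)); have := sqr_ge0 (b - 5 / 4); nra.
apply: le_trans (ler_wpM2l (ler0n _ 8) le_dev).
pose M := 3 * s ^+ 2 + s * (1 - 6 * p * (1 - p)).
rewrite bexpD !bexpZ bexp_sqr bexp_pow4/= subrr -/s.
rewrite (_ : _ + _ = c1 * s + c2 * M); last by rewrite /M; ring.
have s4 : 4^-1 <= s by move: su; rewrite u2; lra.
have pq0 : 0 <= p * (1 - p) by rewrite mulr_ge0//; lra.
(* As [s >= 1/4], the fourth central moment is at most [3 s^2 + s <= 7 s^2]. *)
have M_le : M <= 7 * s ^+ 2.
  rewrite /M -mulrA; move: s4 pq0; clear; move: s (p * (1 - p)) => s q.
  by nra.
have c2_le0 : c2 <= 0 by rewrite oppr_le0 invr_ge0 !mulr_ge0 ?exprn_ge0// ltW.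
have := ler_wnM2l c2_le0 M_le.
suff : u / n%:R <= 8 * (c1 * s + c2 * (7 * s ^+ 2)) by lra.
(* What remains is [4v - 7/4 v^2 - 1 >= 0]: concave in [v], positive at [1/2] and at [1]. *)
pose v := s / u ^+ 2.
have /andP[v1 v2] : 2^-1 <= v <= 1.
  by rewrite ler_pdivlMr ?ler_pdivrMr ?exprn_gt0//; lra.
rewrite -subr_ge0 (_ : _ - _ = u / n%:R * (4 * v - 7 / 4 * v ^+ 2 - 1)).
  by rewrite mulr_ge0 ?divr_ge0 ?(ltW u0)//; nra.
by rewrite /v /c1 /c2; field; rewrite !gt_eqF.
Qed.

(** For [k >= 2] this is [m + 1 <= 2^m] with [m = k - 2]. Dividing by [z^2] makes the expectations
    summable once [z] is proportional to the index. *)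
Lemma le1D_expr_div z k : 2 <= z -> k%:R <= 1 + z ^+ k / z ^+ 2.
Proof.
move=> z2; have z0 : 0 < z by lra.
have zk m : 0 <= z ^+ m by rewrite exprn_ge0// ltW.
case: k => [|[|k]]; rewrite ?lerDl ?addr_ge0 ?divr_ge0//.
have -> : z ^+ k.+2 / z ^+ 2 = z ^+ k.
  by rewrite -[k.+2]addn2 exprD mulfK ?expf_neq0 ?gt_eqF.
apply: (@le_trans _ _ (1 + 2 ^+ k)); last first.
  by rewrite lerD2l lerXn2r// nnegrE; lra.
by rewrite -natrX addrC natr1 ler_nat ltnS ltn_expl.
Qed.

(** The partial sums telescope, from [1/(m+1)^2 <= 1/m - 1/(m+1)]. *)
Lemma nneseries_le_inv_sqr (f : nat -> R) c : (forall j, 0 <= f j) ->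
  (forall j, f j <= c / j.+1%:R ^+ 2) ->
  (\sum_(0 <= j <oo) (f j)%:E <= (2 * c)%:E)%E.
Proof.
move=> f0 fc.
have c0 : 0 <= c by have := le_trans (f0 0%N) (fc 0%N); rewrite expr1n divr1.
have partial m : \sum_(0 <= j < m.+1) f j <= c * (2 - m.+1%:R^-1).
  elim: m => [|m IH].
    rewrite big_nat1 invr1; apply: le_trans (fc 0%N) _.
    by rewrite expr1n divr1; lra.
  rewrite big_nat_recr//=; apply: le_trans (lerD IH (fc _)) _.
  rewrite -mulrDr ler_wpM2l//.
  have m1 : 0 < m.+1%:R :> R by [].
  rewrite -(natr1 m.+1); set x := m.+1%:R in m1 *.
  rewrite -subr_ge0 (_ : _ - _ = (x * (x + 1) ^+ 2)^-1); last by field; lra.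
  by rewrite invr_ge0 mulr_ge0 ?sqr_ge0// ltW.
apply: lime_le; first by apply: is_cvg_nneseries => j _ _; rewrite lee_fin.
near=> m; rewrite sumEFin lee_fin.
have m0 : (0 < m)%N by near: m; exact: nbhs_infty_gt.
rewrite -(prednK m0); apply: le_trans (partial _) _.
by rewrite mulrC ler_wpM2r// gerBl invr_ge0.
Unshelve. all: end_near. Qed.

(* The tilt [min (sqrt r) (ln (2 + r))], [r = L / (np)], makes the cumulants
   [np (e^(+-t) - 1 -+ t)] at most [9 L], while [L / (n t)] is the maximum of
   the subgaussian and the Poisson scales. *)
Lemma tilt_bounds r : 0 < r ->
  let t := Num.min (Num.sqrt r) (ln (2 + r)) in
  [/\ 0 < t, expR t - 1 - t <= 9 * r & expR (- t) - 1 + t <= 9 * r].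
Proof.
move=> r0 t.
have t0 : 0 < t by rewrite lt_min sqrtr_gt0 r0 ln_gt0//; lra.
have t2 : t ^+ 2 <= r.
  rewrite -[leRHS]sqr_sqrtr ?(ltW r0)// lerXn2r ?nnegrE ?sqrtr_ge0 ?(ltW t0)//.
  by rewrite ge_min lexx.
have te : expR t <= 2 + r.
  rewrite -[leRHS]lnK ?posrE; last by lra.
  by rewrite ler_expR ge_min lexx orbT.
split=> //.
(* If [r > 1/4], then [e^t - 1 - t <= 1 + r <= 5r]; otherwise [t <= 1/2] and the quadratic bound
   gives [2 t^2 <= 2r]. *)
- have [r4|r4] := lerP r (4^-1); last by lra.
  have /expR_le_quadratic : t <= 2^-1.
    by rewrite -ler_sqr ?nnegrE ?(ltW t0)//; lra.
  by lra.
- have /expR_le_quadratic : - t <= 2^-1 by lra.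
  by rewrite sqrrN; lra.
Qed.

(** [L] stands for the logarithm attached to a coordinate, so that the factor [e^(-2L)] is summable
    over the coordinates. *)
Lemma deviation_dominated n p L S : (1 <= n)%N -> 0 <= p <= 1 ->
  2^-1 <= L -> Num.sqrt (p * L / n%:R) <= S ->
  (p != 0 -> L / (n%:R * ln (2 + L / (n%:R * p))) <= S) ->
  exists Z : nat -> R, [/\ forall k, 0 <= Z k,
    forall k, `|k%:R / n%:R - p| <= 11 * S + Z k &
    bexp n p Z <= 4 * S / expR L ^+ 2].
Proof.
move=> n1 p01 L2 S1 S2.
have S0 : 0 <= S by apply: le_trans S1.
have [p0|pn0] := eqVneq p 0.
  (* For [p = 0] the count vanishes almost surely, so [N / n] itself has expectation 0. *)
  exists (fun k => n%:R^-1 * k%:R); split => [k|k|].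
  - by rewrite mulr_ge0 ?invr_ge0.
  - by rewrite p0 subr0 ger0_norm ?divr_ge0// mulrC lerDr mulr_ge0.
  - by rewrite bexpZ bexp_id p0 !mulr0 divr_ge0 ?mulr_ge0 ?exprn_ge0 ?expR_ge0.
have {}S2 := S2 pn0.
have p_gt0 : 0 < p by rewrite lt_neqAle eq_sym pn0; case/andP: p01.
have n0 : 0 < n%:R :> R by rewrite ltr0n.
have np0 : 0 < n%:R * p by rewrite mulr_gt0.
pose r := L / (n%:R * p).
have r0 : 0 < r by rewrite divr_gt0//; lra.
have [] := tilt_bounds r r0.
set t := Num.min _ _ => t0 cum_pos cum_neg.
have LtS : L / (n%:R * t) <= S.
  rewrite /t /Num.min; case: ifP => _ //.
  apply: le_trans S1.
  rewrite -[leLHS]ger0_norm; last first.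
    by rewrite divr_ge0 ?mulr_ge0 ?sqrtr_ge0//; lra.
  rewrite -sqrtr_sqr ler_sqrt; last by rewrite divr_ge0 ?mulr_ge0//; lra.
  rewrite expr_div_n exprMn sqr_sqrtr ?(ltW r0)// /r le_eqVlt.
  by apply/orP; left; apply/eqP; field; rewrite !gt_eqF//; lra.
(* The cumulants cost [9 L]; the remaining [2 L] yields the factor [e^(-2L)]. *)
pose A := 11 * L.
(* The two exponentials together dominate [e^(t |y|)]; the factor [2 S] bounds [1 / (n t)], since
   [L >= 1/2]. *)
pose Z k : R := 2 * S * (expR (- A) *
  (expR (t * (k%:R - n%:R * p)) + expR (- t * (k%:R - n%:R * p)))).
have Z0 k : 0 <= Z k by rewrite !mulr_ge0 ?addr_ge0 ?expR_ge0.
exists Z; split => // [k|].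
- pose y := k%:R - n%:R * p.
  have -> : k%:R / n%:R - p = y / n%:R by rewrite /y; field; rewrite gt_eqF.
  rewrite normrM (@ger0_norm _ n%:R^-1) ?invr_ge0//.
  rewrite /Z -/y; set E := expR (- A) * _.
  have E0 : 0 <= E by rewrite mulr_ge0 ?addr_ge0 ?expR_ge0.
  have tyE : t * `|y| <= A + E.
    apply: (@le_trans _ _ (A + expR (t * `|y| - A))).
      by have := expR_ge1Dx (t * `|y| - A); lra.
    rewrite lerD2l addrC expRD ler_wpM2l ?expR_ge0//.
    have [y0|y0] := lerP 0 y; first by rewrite ger0_norm// lerDl expR_ge0.
    by rewrite ltr0_norm// mulrN mulNr lerDr expR_ge0.
  have -> : `|y| / n%:R = (t * `|y|) / (n%:R * t).
    by field; rewrite !gt_eqF.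
  have -> : 11 * S + 2 * S * E = S * (11 + 2 * E) by ring.
  apply: (@le_trans _ _ (L / (n%:R * t) * (11 + 2 * E))); last first.
    by rewrite ler_wpM2r// addr_ge0// mulr_ge0.
  rewrite [leRHS]mulrAC ler_wpM2r ?invr_ge0 ?mulr_ge0 ?(ltW t0)//.
  by apply: le_trans tyE _; rewrite /A; nra.
- rewrite /Z !bexpZ bexpD.
  have := bexp_expR_le n p t p01; have := bexp_expR_le n p (- t) p01.
  have npr : n%:R * p * (9 * r) = 9 * L by rewrite /r; field; rewrite !gt_eqF.
  have en : expR (n%:R * p * (expR (- t) - 1 - - t)) <= expR (9 * L).
    by rewrite ler_expR -npr ler_wpM2l ?(ltW np0)// opprK.
  have ep : expR (n%:R * p * (expR t - 1 - t)) <= expR (9 * L).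
    by rewrite ler_expR -npr ler_wpM2l ?(ltW np0).
  move=> /le_trans/(_ en) bn /le_trans/(_ ep) bp.
  have -> : 4 * S / expR L ^+ 2 =
      2 * S * (expR (- A) * (expR (9 * L) + expR (9 * L))).
    rewrite -expRM_natl -expRN -[in LHS](_ : - A + 9 * L = - (2 * L)).
      by rewrite expRD; ring.
    by rewrite /A; ring.
  by rewrite !ler_wpM2l ?mulr_ge0 ?expR_ge0// lerD.
Qed.

End binomial_deviation.

(** * Assembly of the two regimes *)

Theorem corollary3 (R : realType) :
  exists C : R, 0 < C /\
  forall (n : nat) (mu : probability binseq R)
    (d : measure_display) (Omega : measurableType d)
    (P : probability Omega R) (X : 'I_n -> {RV P >-> binseq}),
  (1 <= n)%N ->
  iid_samples mu X ->
  (forall j : nat, 0 <= mean mu j <= 2^-1) ->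
  (forall j : nat, mean mu j.+1 <= mean mu j) ->
  ((forall j : nat, mean mu j <= (2 * n%:R * j.+1%:R)^-1) ->
     ((mean mu 0%N)%:E <= C%:E * Delta mu X)%E /\
     (Delta mu X <=
        C%:E * mine (n%:R^-1)%:E (\sum_(0 <= j <oo) (mean mu j)%:E))%E) /\
  (~ (forall j : nat, mean mu j <= (2 * n%:R * j.+1%:R)^-1) ->
     ((Num.min (mean mu 0%N) (Num.sqrt (mean mu 0%N / n%:R)))%:E
        <= C%:E * Delta mu X)%E /\
     (Delta mu X <=
        C%:E * mine 1 (ereal_sup (range (fun j : nat =>
          (Num.max (Num.sqrt (mean mu j * ln j.+2%:R / n%:R))
                   (poisson_term n j (mean mu j)))%:E))))%E).
Proof.
(* The largest factor needed is [11 + 8 = 19], in the upper bound of (ii). *)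
exists 20; split=> [//|n mu d Omega P X n1 iidX mean_half _].
have mean_le1 := mean_ge0_le1 mu.
have mean_ge0 j : 0 <= mean mu j by case/andP: (mean_half j).
have n0 : 0 < n%:R :> R by rewrite ltr0n.
have ni0 : 0 <= n%:R^-1 :> R by rewrite invr_ge0.
have Delta_ge_of (x c : R) : 0 <= c <= 20 ->
    x <= c * bexp n (mean mu 0%N) (fun k => `|k%:R / n%:R - mean mu 0%N|) ->
    (x%:E <= 20%:E * Delta mu X)%E.
  move=> /andP[c0 c20] xc.
  have := Delta_ge _ _ _ _ iidX 0%N; set b := bexp _ _ _ in xc * => bDelta.
  have b0 : 0 <= b by apply: bexp_ge0.
  apply: (@le_trans _ _ (20%:E * b%:E)%E); last by rewrite lee_pmul2l.
  by rewrite -EFinM lee_fin (le_trans xc)// ler_wpM2r.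
have le_mine (x y : \bar R) : (Delta mu X <= 20%:E * x)%E ->
    (Delta mu X <= 20%:E * y)%E -> (Delta mu X <= 20%:E * mine x y)%E.
  by move=> hx hy; rewrite minEle; case: ifP.
split=> [small|_]; split.
- apply: (Delta_ge_of _ 2); first by lra.
  have np : n%:R * mean mu 0%N <= 2^-1.
    have := ler_wpM2l (ltW n0) (small 0%N); rewrite mulr1 => /le_trans; apply.
    by rewrite invfM mulrCA mulfV ?mulr1// gt_eqF.
  by have := bexp_norm_ge_mean n (mean mu 0%N) n1 (mean_le1 0%N) np; lra.
- apply: le_mine.
  (* With [z = 2 (j + 1)], smallness gives [n p_j z <= 1], hence [E z^N <= e <= 4] and
     [E Z_j <= 1 / (n (j + 1)^2)]. *)
  + pose Z j k : R := n%:R^-1 / (2 * j.+1%:R) ^+ 2 * (2 * j.+1%:R) ^+ k.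
    have z0 j : 0 < 2 * j.+1%:R :> R by rewrite mulr_gt0.
    have np j : n%:R * mean mu j * (2 * j.+1%:R) <= 1.
      have := ler_wpM2l (ltW n0) (small j).
      have -> : n%:R * (2 * n%:R * j.+1%:R)^-1 = (2 * j.+1%:R)^-1 :> R.
        by field; rewrite !gt_eqF.
      by rewrite -[_^-1]mul1r ler_pdivlMr.
    have Z0 j k : 0 <= Z j k.
      by rewrite mulr_ge0 ?divr_ge0 ?exprn_ge0 ?(ltW (z0 j)).
    (* [3/2] adds the 1 of [N <= 1 + z^(N - 2)] and the bound [p_j <= 1/(2n)]. *)
    apply: le_trans (Delta_le _ _ _ _ iidX (3 / 2 * n%:R^-1) Z _ Z0 _) _.
    * by rewrite mulr_ge0.
    * move=> j k _.
      have z2 : 2 <= 2 * j.+1%:R :> R by rewrite ler_peMr// ler1n.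
      have kz := le1D_expr_div _ k z2.
      have pn : mean mu j <= n%:R^-1 / 2.
        rewrite -[n%:R^-1]mul1r mulrAC ler_pdivlMr//.
        by have := np j; have := mean_ge0 j; nra.
      have /= := ler_wpM2l ni0 kz.
      have := mean_ge0 j; have kn0 : 0 <= k%:R / n%:R :> R by rewrite divr_ge0.
      have -> : Z j k = n%:R^-1 * ((2 * j.+1%:R) ^+ k / (2 * j.+1%:R) ^+ 2).
        by rewrite /Z mulrAC mulrA.
      move: (_ / (2 * _) ^+ 2) => b.
      by rewrite mulrDr ler_norml => *; apply/andP; split; lra.
    * apply: (@le_trans _ _ ((3 / 2 * n%:R^-1)%:E + (2 * n%:R^-1)%:E)%E).
        apply: leeD2l; apply: nneseries_le_inv_sqr => j.
          exact: bexp_ge0.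
        have mgf : bexp n (mean mu j) (fun k => (2 * j.+1%:R) ^+ k) <= 4.
          apply: le_trans (bexp_expr_le _ _ _ (mean_le1 j) (ltW (z0 j))) _.
          apply: le_trans expR1_le4; rewrite ler_expR.
          have npj0 : 0 <= n%:R * mean mu j by rewrite mulr_ge0.
          by have := np j; lra.
        rewrite /Z bexpZ; apply: le_trans (ler_wpM2l _ mgf) _.
          by rewrite divr_ge0 ?exprn_ge0 ?(ltW (z0 j)).
        rewrite le_eqVlt; apply/orP; left; apply/eqP.
        by field; rewrite !gt_eqF.
      by rewrite -EFinD -EFinM lee_fin; lra.
  (* Here the union bound is applied to the deviations themselves, each of mean at most [2 p_j]. *)
  + pose Z j k : R := `|k%:R / n%:R - mean mu j|.
    apply: le_trans (Delta_le _ _ _ _ iidX 0 Z _ _ _) _ => //.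
    * by move=> j k; exact: normr_ge0.
    * by move=> j k _; rewrite add0r.
    * rewrite add0e -nneseriesZl//; last by move=> *; rewrite lee_fin.
      apply: lee_nneseries => [j _ _|j _].
        by rewrite lee_fin bexp_ge0// => k; exact: normr_ge0.
      rewrite -EFinM lee_fin.
      apply: (@le_trans _ _
          (bexp n (mean mu j) (fun k => n%:R^-1 * k%:R + mean mu j))).
        apply: le_bexp => // k; apply: le_trans (ler_normB _ _) _.
        by rewrite !ger0_norm ?divr_ge0// mulrC.
      rewrite bexpD bexpZ bexp_id bexp_cst mulrA mulVf ?gt_eqF// mul1r.
      by have := mean_ge0 j; lra.
(* Each side of [np = 1/2] bounds one argument of the minimum. *)
- have [np|np] := lerP (n%:R * mean mu 0%N) (2^-1).
    apply: (Delta_ge_of _ 2); first by lra.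
    rewrite ge_min; apply/orP; left.
    by have := bexp_norm_ge_mean n (mean mu 0%N) n1 (mean_le1 0%N) np; lra.
  apply: (Delta_ge_of _ 8); first by lra.
  rewrite ge_min; apply/orP; right.
  exact: bexp_norm_ge_sqrt (ltW np).
- apply: le_mine.
    apply: le_trans (Delta_le _ _ _ _ iidX 1 (fun _ _ => 0) _ _ _) _ => //.
      move=> j k kn; rewrite addr0; have /andP[m0 m1] := mean_le1 j.
      suff /andP[e0 e1] : (0 <= k%:R / n%:R :> R) && (k%:R / n%:R <= 1 :> R).
        by rewrite ler_norml; lra.
      by rewrite divr_ge0//= ler_pdivrMr// mul1r ler_nat.
    rewrite eseries0 ?adde0 ?mule1 ?lee_fin ?ler1n//.
    by move=> j _ _; rewrite bexp_cst.
  set a := fun j : nat => _.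
  have leF j : (a j <= ereal_sup (range a))%E.
    by apply: ereal_sup_ubound; exists j.
  (* An infinite supremum makes the bound trivial; it cannot be [-oo], since [a 0] is real. *)
  case: (ereal_sup _) leF => [S leF|_|/(_ 0%N)//]; last first.
    by rewrite gt0_muley ?lte_fin ?leey.
  have Fj j : exists Z : nat -> R, [/\ forall k, 0 <= Z k,
    forall k, `|k%:R / n%:R - mean mu j| <= 11 * S + Z k &
    bexp n (mean mu j) Z <= 4 * S / expR (ln j.+2%:R) ^+ 2].
    have := leF j; rewrite lee_fin ge_max => /andP[S1 S2].
    apply: deviation_dominated => //.
      (* [ln 2 >= 1/2] because [e^(1/2) <= 2]. *)
      rewrite -[leLHS]expRK ler_ln ?posrE ?expR_gt0//.
      apply: (@le_trans _ _ 2); last by rewrite ler_nat.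
      by have /expR_le_quadratic : 2^-1 <= 2^-1 :> R by []; lra.
    by move=> pn0; move: S2; rewrite /poisson_term (negPf pn0).
  have [Z HZ] := choice Fj.
  have S0 : 0 <= S.
    have := leF 0%N; rewrite lee_fin ge_max => /andP[S1 _].
    exact: le_trans S1.
  have Z0 j k : 0 <= Z j k by case: (HZ j).
  apply: le_trans (Delta_le _ _ _ _ iidX (11 * S) Z _ Z0 _) _.
  + by rewrite mulr_ge0.
  + by move=> j k _; case: (HZ j).
  apply: (@le_trans _ _ ((11 * S)%:E + (2 * (4 * S))%:E)%E).
    apply: leeD2l; apply: nneseries_le_inv_sqr => j; first exact: bexp_ge0.
    (* With [j] counted from 0, [e^(2L)] is [(j + 2)^2], at least the [(j + 1)^2] of the series
       bound. *)
    case: (HZ j) => _ _ /le_trans; apply; rewrite lnK ?posrE//.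
    rewrite ler_wpM2l ?mulr_ge0// lef_pV2 ?posrE ?exprn_gt0//.
    by rewrite lerXn2r ?nnegrE// ler_nat.
  by rewrite -EFinD -EFinM lee_fin; lra.
Qed.
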